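(* Let $X$ be a metric space and let $n\ge 0$ be an integer. Suppose that for every $\epsilon>0$ there is $\delta>0$ such that the following holds: for every simplicial complex $K$, every subset $A\subset X$, every $\delta$-partition of unity $f\colon X\to K$ and every function $g\colon A\to K^{(n)}$ with $g(a)=f(a)$ for all $a\in A$, there is a function $h\colon X\to K^{(n)}$ that is an $\epsilon$-partition of unity and a filler, i.e. $h|_A=g$ and, for every $x\in X$ and every simplex $\Delta$ of $K$, $f(x)\in\Delta$ implies $h(x)\in\Delta$. If $X$ is large scale paracompact, then the asymptotic dimension of $X$ is at most $n$.
   Context: Simplicial complexes: for a set $S$, $\Delta(S)$ is the set of functions $p\colon S\to[0,1]$ with finite support and $\sum_{s\in S}p(s)=1$, with the metric inherited from $l^1(S)$, i.e. $d(p,q)=\|p-q\|_1=\sum_{s}|p(s)-q(s)|$. A simplicial complex $K$ is a subcomplex of $\Delta(S)$ for some set $S$ (a union of closed simplices $\{p\in\Delta(S): p(s)=0 \text{ for } s\notin T\}$, $T\subset S$ finite nonempty), with the induced metric. $K^{(0)}$ is its set of vertices, and $K^{(n)}$ is its $n$-skeleton (the points of $K$ whose support has at most $n+1$ elements), itself a simplicial complex. The star of a vertex $v\in K^{(0)}$ is $st(v)=\{p\in K: p(v)>0\}$. A function $f\colon X\to Y$ of metric spaces (not necessarily continuous) is $(\lambda,C)$-Lipschitz if $d_Y(f(x),f(y))\le\lambda\, d_X(x,y)+C$ for all $x,y\in X$. A family of subsets of $X$ is uniformly bounded if the diameters of its members have a common finite upper bound. A cover $\mathcal U$ refines a cover $\mathcal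 V$ if each member of $\mathcal U$ is contained in some member of $\mathcal V$. The Lebesgue number of a cover $\mathcal U=\{U_s\}_{s\in S}$ of $X$ is $L(\mathcal U)=\inf_{x\in X}\sup_{s\in S}\mathrm{dist}(x,X\setminus U_s)$ (with $\mathrm{dist}(x,\emptyset)=\infty$). For $\delta>0$, a function $f\colon X\to K$ is a $\delta$-partition of unity if it is $(\delta,\delta)$-Lipschitz, the family $\mathcal V=\{f^{-1}(st(v))\}_{v\in K^{(0)}}$ is uniformly bounded, and the Lebesgue number of $\mathcal V$ is at least $\frac1\delta$. $X$ is large scale paracompact if for each uniformly bounded cover $\mathcal U$ of $X$ and all $\lambda,C>0$ there are a simplicial complex $K$ and a $(\lambda,C)$-Lipschitz function $f\colon X\to K$ such that $\mathcal V:=\{f^{-1}(st(v))\}_{v\in K^{(0)}}$ is uniformly bounded and $\mathcal U$ refines $\mathcal V$. $X$ has asymptotic dimension at most $n$ if for every $R>0$ there is a uniformly bounded cover of $X$ with Lebesgue number at least $R$ such that every point of $X$ belongs to at most $n+1$ members of the cover. *)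

(* Defs.v *)
(* MathComp-Analysis: the reals are an arbitrary R : realType, metric spaces
   are metricType R. *)
From HB Require Import structures.
From mathcomp Require Import all_boot all_order all_algebra.
From mathcomp Require Import all_classical all_reals.
From mathcomp Require Import ereal topology.

Set Implicit Arguments.
Unset Strict Implicit.
Unset Printing Implicit Defensive.

Import Order.TTheory GRing.Theory Num.Theory.
Local Open Scope classical_set_scope.
Local Open Scope card_scope.
Local Open Scope ring_scope.

(* Families {U_i}_{i in D} of subsets are given by an index set D : set I and
   U : I -> set X; values of U outside D are irrelevant. *)

Section MetricFamilies.
Variables (R : realType) (X : metricType R) (I : Type).
Implicit Types (D : set I) (U : I -> set X).

(* diam set0 = -oo, which is harmless as diam is only bounded from above. *)
Definition diam (A : set X) : \bar R :=
  ereal_sup [set (mdist z.1 z.2)%:E | z in A `*` A].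

Definition uniformly_bounded D U :=
  exists M : R, forall i, D i -> (diam (U i) <= M%:E)%E.

(* dist x set0 = +oo. *)
Definition dist (x : X) (A : set X) : \bar R :=
  ereal_inf [set (mdist x y)%:E | y in A].

Definition lebesgue_number D U : \bar R :=
  ereal_inf [set ereal_sup [set dist x (~` U i) | i in D] | x in [set: X]].

End MetricFamilies.

Definition refines (X I J : Type) (D : set I) (U : I -> set X)
    (E : set J) (V : J -> set X) :=
  forall i, D i -> exists2 j, E j & U i `<=` V j.

(* (lambda, C)-Lipschitz *)
Definition coarse_lipschitz (R : realType) (X Y : metricType R)
    (lambda C : R) (f : X -> Y) :=
  forall x y, mdist (f x) (f y) <= lambda * mdist x y + C.

Definition asdim_le (R : realType) (X : metricType R) (n : nat) :=
  forall r : R, 0 < r ->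
  exists (I : Type) (D : set I) (U : I -> set X),
    [/\ cover D U = [set: X],
        uniformly_bounded D U,
        (r%:E <= lebesgue_number D U)%E &
        forall x, [set i | D i /\ U i x] #<= `I_n.+1].

(* The full simplex Delta(S). *)
Record Delta (R : realType) (S : choiceType) := MkDelta {
  bary :> S -> R;
  bary_itv : forall s, 0 <= bary s <= 1;
  bary_finite : finite_set [set s | bary s != 0];
  bary_sum : \sum_(s \in [set: S]) bary s = 1 }.

Section Metric.
Variables (R : realType) (S : choiceType).
Implicit Types p q r : Delta R S.

HB.instance Definition _ := gen_eqMixin (Delta R S).
HB.instance Definition _ := gen_choiceMixin (Delta R S).

Definition supp p : set S := [set s | p s != 0].

Lemma Delta_eq p q : p =1 q -> p = q.
Proof.
case: p q => [p p1 p2 p3] [q q1 q2 q3] /= /funext pq; subst q.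
by congr MkDelta; exact: Prop_irrelevance.
Qed.

(* The sum is effectively finite, since p and q have finite supports. *)
Definition l1_dist p q : R := \sum_(s \in [set: S]) `|p s - q s|.

Lemma l1_dist_on (B : set S) p q : finite_set B -> supp p `|` supp q `<=` B ->
  l1_dist p q = \sum_(s \in B) `|p s - q s|.
Proof.
move=> finB suppB; rewrite /l1_dist; apply/esym/fsbig_widen => // s [_ nBs] /=.
have [ps|/eqP ps] := eqVneq (p s) 0; last first.
  by case: nBs; apply: suppB; left; apply/eqP.
have [qs|/eqP qs] := eqVneq (q s) 0; last first.
  by case: nBs; apply: suppB; right; apply/eqP.
by rewrite ps qs subrr normr0.
Qed.

Lemma l1_distxx p : l1_dist p p = 0.
Proof. by apply: fsbig1 => s _; rewrite subrr normr0. Qed.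

Lemma l1_dist_positivity p q : l1_dist p q = 0 -> p = q.
Proof.
have finB : finite_set (supp p `|` supp q).
  by rewrite finite_setU; split; exact: bary_finite.
rewrite (l1_dist_on finB)// => pq0; apply: Delta_eq => s.
have [sB|nsB] := pselect ((supp p `|` supp q) s).
  apply/eqP; rewrite -subr_eq0 -normr_eq0; apply/eqP.
  exact: (pfsumr_eq0 finB _ pq0).
have [ps|ps] := eqVneq (p s) 0; last by case: nsB; left.
have [qs|qs] := eqVneq (q s) 0; last by case: nsB; right.
by rewrite ps qs.
Qed.

Lemma l1_dist_sym p q : l1_dist p q = l1_dist q p.
Proof. by apply: eq_fsbigr => s _; rewrite distrC. Qed.

Lemma l1_dist_triangle q p r : l1_dist p r <= l1_dist p q + l1_dist q r.
Proof.
pose B := supp p `|` supp q `|` supp r.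
have finB : finite_set B.
  by rewrite /B !finite_setU; do !split; exact: bary_finite.
have pB : supp p `<=` B by move=> s ps; left; left.
have qB : supp q `<=` B by move=> s qs; left; right.
have rB : supp r `<=` B by move=> s rs; right.
rewrite !(l1_dist_on finB); do ?by rewrite subUset.
rewrite -fsbig_split//= !fsbig_finite//; apply: ler_sum => s _.
by rewrite (le_trans _ (ler_normD _ _))// addrA subrK.
Qed.

HB.instance Definition _ := @isMetric.Build R (Delta R S) l1_dist
  l1_distxx l1_dist_positivity l1_dist_sym l1_dist_triangle.

End Metric.

Section Complexes.
Variables (R : realType) (S : choiceType).
Implicit Types (T : set S) (K : set (Delta R S)).

Definition simplex T : set (Delta R S) := [set p | forall s, ~ T s -> p s = 0].

(* K, with the metric induced by Delta(S), is a simplicial complex. *)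
Definition simplicial_complex K :=
  exists2 F : set (set S), (forall T, F T -> finite_set T /\ T !=set0) &
    K = \bigcup_(T in F) simplex T.

(* The simplices of K are the sets simplex T with simplex_of K T. *)
Definition simplex_of K T :=
  [/\ finite_set T, T !=set0 & simplex T `<=` K].

(* A vertex, i.e. the indicator function of some v : S, is identified with v. *)
Definition vertices K : set S := [set v | exists2 p, K p & p v = 1].

Definition skeleton (n : nat) K : set (Delta R S) :=
  [set p | K p /\ supp p #<= `I_n.+1].

Definition star K (v : S) : set (Delta R S) := [set p | K p /\ 0 < p v].

Lemma supp_nonempty (p : Delta R S) : supp p !=set0.
Proof.
apply: contrapT => /set0P/negP/negPn/eqP p0.
have := bary_sum p; rewrite fsbig1.
  by move/esym/eqP; rewrite oner_eq0.
move=> s _; apply/eqP/negPn/negP => ps.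
by have : supp p s by []; rewrite p0.
Qed.

Lemma skeleton_complex n K :
  simplicial_complex K -> simplicial_complex (skeleton n K).
Proof.
case=> F F0 ->.
exists [set T | [/\ finite_set T, T !=set0, T #<= `I_n.+1 &
                    exists2 T', F T' & T `<=` T']].
  by move=> T [].
apply/seteqP; split => [p [[T FT Tp] pn]|p [T [fT T0 Tn [T' FT' TT']] Tp]].
  exists (supp p).
    split=> //; [exact: bary_finite|exact: supp_nonempty|].
    exists T => // s ps; apply: contrapT => nTs.
    by move: ps; rewrite /supp /= (Tp _ nTs) eqxx.
  by move=> s /negP/negPn/eqP.
split; first by exists T' => // s nT's; apply: Tp => /TT'.
apply: card_le_trans Tn; apply: subset_card_le => s ps.
by apply: contrapT => nTs; move: ps; rewrite /supp /= (Tp _ nTs) eqxx.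
Qed.

End Complexes.

(* The members f^-1(st(v)) of the family indexed by the vertices v of K. *)
Definition star_preimage (R : realType) (S : choiceType) (X : Type)
    (K : set (Delta R S)) (f : X -> Delta R S) (v : S) : set X :=
  f @^-1` star K v.

(* f : X -> K is a delta-partition of unity. *)
Definition partition_of_unity (R : realType) (S : choiceType)
    (X : metricType R) (delta : R) (K : set (Delta R S)) (f : X -> Delta R S) :=
  [/\ forall x, K (f x),
      coarse_lipschitz delta delta f,
      uniformly_bounded (vertices K) (star_preimage K f) &
      ((delta^-1)%:E <= lebesgue_number (vertices K) (star_preimage K f))%E].

Definition large_scale_paracompact (R : realType) (X : metricType R) :=
  forall (I : Type) (D : set I) (U : I -> set X),
    cover D U = [set: X] -> uniformly_bounded D U ->
  forall lambda C : R, 0 < lambda -> 0 < C ->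
  exists (S : choiceType) (K : set (Delta R S)) (f : X -> Delta R S),
    [/\ simplicial_complex K,
        forall x, K (f x),
        coarse_lipschitz lambda C f,
        uniformly_bounded (vertices K) (star_preimage K f) &
        refines D U (vertices K) (star_preimage K f)].

(* g is defined on A only; h extends g, and h x lies in every simplex of K
   that contains f x. *)
Definition filler (R : realType) (S : choiceType) (X : Type)
    (K : set (Delta R S)) (f : X -> Delta R S)
    (A : set X) (g : A -> Delta R S) (h : X -> Delta R S) :=
  (forall a : A, h (\val a) = g a) /\
  (forall (x : X) (T : set S), simplex_of K T ->
     simplex T (f x) -> simplex T (h x)).

(* Main.v *)
(* Large scale paracompactness, applied to the cover by balls of radius
   1/delta, yields a delta-partition of unity f into some complex K. Filling it
   over A = set0 gives an eps-partition of unity h into the n-skeleton, with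
   eps = 1/r. The preimages of stars under h form the required cover, since
   x lies in one of them for each element of the support of h x. *)

Require Import Defs.
From HB Require Import structures.
From mathcomp Require Import all_boot all_order all_algebra.
From mathcomp Require Import all_classical all_reals.
From mathcomp Require Import ereal topology.

Set Implicit Arguments.
Unset Strict Implicit.
Unset Printing Implicit Defensive.

Import Order.TTheory GRing.Theory Num.Theory.
Local Open Scope classical_set_scope.
Local Open Scope ring_scope.

Lemma dist_le0 (R : realType) (X : metricType R) (x : X) (A : set X) :
  A x -> (dist x A <= 0)%E.
Proof. by move=> Ax; apply: ereal_inf_lbound; exists x => //; rewrite mdistxx. Qed.

(** A point outside [U i] is outside the ball around [x], hence at distance at least [r] from [x].
    The index [i] may vary with [x], as the supremum is taken inside the infimum. *)
Lemma lebesgue_number_ge (R : realType) (X : metricType R) (I : Type)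
    (D : set I) (U : I -> set X) (r : R) :
  (forall x, exists2 i, D i & [set y | mdist x y < r] `<=` U i) ->
  (r%:E <= lebesgue_number D U)%E.
Proof.
move=> ballU; apply: le_ereal_inf_tmp => _ [x _ <-].
have [i Di xUi] := ballU x.
apply: (@le_trans _ _ (dist x (~` U i))); last first.
  by apply: ereal_sup_ubound; exists i.
apply: le_ereal_inf_tmp => _ [y nUiy <-]; rewrite lee_fin leNgt.
by apply/negP => /xUi.
Qed.

Lemma lebesgue_number_cover (R : realType) (X : metricType R) (I : Type)
    (D : set I) (U : I -> set X) :
  (0 < lebesgue_number D U)%E -> cover D U = [set: X].
Proof.
move=> L0; apply/seteqP; split=> // x _; apply: contrapT => nUx.
have: (lebesgue_number D U <= 0)%E.
  apply: le_trans (ge_ereal_sup _); first by apply: ereal_inf_lbound; exists x.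
  move=> _ [i Di <-]; apply: dist_le0 => Uix.
  by apply: nUx; exists i.
by rewrite leNgt L0.
Qed.

Lemma uniformly_bounded_balls (R : realType) (X : metricType R) (r : R) :
  uniformly_bounded [set: X] (fun x => [set y | mdist x y < r]).
Proof.
exists (r + r) => x _; apply: ge_ereal_sup => _ [[y z] /= [xy xz] <-].
rewrite lee_fin (le_trans (metric_triangle _ x _))// lerD//.
  by rewrite metric_sym ltW.
exact: ltW.
Qed.

Lemma large_scale_paracompact_partition (R : realType) (X : metricType R)
    (delta : R) :
  large_scale_paracompact X -> 0 < delta ->
  exists (S : choiceType) (K : set (Delta R S)) (f : X -> Delta R S),
    simplicial_complex K /\ partition_of_unity delta K f.
Proof.
move=> lsp d0; pose B (x : X) := [set y | mdist x y < delta^-1].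
have cB : cover [set: X] B = [set: X].
  by apply/seteqP; split=> // x _; exists x => //; rewrite /B/= mdistxx invr_gt0.
have [S [K [f [cK Kf lf bf rf]]]] :=
  lsp X _ B cB (uniformly_bounded_balls X delta^-1) delta delta d0 d0.
exists S, K, f; split=> //; split=> //.
(* Refinement says precisely that each ball of radius [delta^-1] lies in one star preimage. *)
by apply: lebesgue_number_ge => x; exact: rf.
Qed.

Theorem theorem1p5 (R : realType) (X : metricType R) (n : nat) :
  (forall eps : R, 0 < eps ->
   exists2 delta : R, 0 < delta &
   forall (S : choiceType) (K : set (Delta R S)) (A : set X)
          (f : X -> Delta R S) (g : A -> Delta R S),
     simplicial_complex K ->
     partition_of_unity delta K f ->
     (forall a : A, skeleton n K (g a)) ->
     (forall a : A, g a = f (\val a)) ->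
   exists2 h : X -> Delta R S,
     partition_of_unity eps (skeleton n K) h & filler K f g h) ->
  large_scale_paracompact X ->
  asdim_le X n.
Proof.
move=> fill lsp r r0.
have [delta d0 filld] := fill r^-1 (eqbRL (invr_gt0 r) r0).
have [S [K [f [cK puf]]]] := large_scale_paracompact_partition lsp d0.
(* The partial map [g] on [set0] and its two conditions are all obtained by elimination of
   [False]. *)
have set0_false (a : (set0 : set X)) : False by have := set_valP a.
have [h [Kh _ bh]] := filld S K set0 f (fun a => False_rect _ (set0_false a))
  cK puf (fun a => False_ind _ (set0_false a))
  (fun a => False_ind _ (set0_false a)).
rewrite invrK => Lh _.
exists S, (vertices (skeleton n K)), (star_preimage (skeleton n K) h).
split=> //.
  by apply: lebesgue_number_cover; apply: lt_le_trans Lh; rewrite lte_fin.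
(* Membership of [h x] in the skeleton bounds its support by [n.+1] elements, and every vertex whose
   star contains [h x] is in that support. *)
move=> x; have [_] := Kh x; apply: card_le_trans; apply: subset_card_le.
by move=> v [_ [_ hxv]]; rewrite /supp/= gt_eqF.
Qed.
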